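(* For every $\epsilon>0$, if $n$ is a sufficiently large primorial number, then the number of irreducible factorizations of $nC_n$ is at least $$n^{2^{\frac{\ln n}{(1+\epsilon)\ln \ln n}}}.$$
   Context: A sum of cycles is a finite digraph that is a disjoint union of directed cycles, considered up to isomorphism. $C_\ell$ is the directed cycle of length $\ell$ and $nC_\ell$ is the disjoint union of $n$ copies of $C_\ell$. The sum $A+B$ is disjoint union, and the product $AB$ is the direct product of digraphs, i.e. the distributive product with $C_aC_b=\gcd(a,b)\,C_{\operatorname{lcm}(a,b)}$. A sum of cycles $X$ is irreducible if, for all sums of cycles $A,B$, $X=AB$ implies $A=C_1$ or $B=C_1$. The number of irreducible factorizations of a sum of cycles $X$ is the number of ways of expressing $X$ as a product of irreducible sums of cycles, each distinct from $C_1$, the order of the factors being irrelevant (i.e. the number of finite multisets of irreducible sums of cycles different from $C_1$ whose product is $X$). The $k$th primorial number is the product of the first $k$ primes; a primorial number is a $k$th primorial number for some $k\ge1$. *)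

(* Defs.v *)
From HB Require Import structures.
From mathcomp Require Import all_boot all_order all_algebra finmap multiset.
From mathcomp Require Import boolp classical_sets functions cardinality.
From mathcomp Require Import reals exp.

Set Implicit Arguments.
Unset Strict Implicit.
Unset Printing Implicit Defensive.

Local Open Scope nat_scope.

(* An isomorphism class of disjoint unions of directed cycles is represented by
   the multiset of the lengths of its cycles; disjoint union is then the sum of
   multisets.  That this representation is exact, and that [scmul] below is the
   direct product of digraphs, is proved at the end of the file (lemmas
   [sum_of_cyclesP], [digraph_of_inj], [digraph_of_add], [digraph_of_mul]). *)

Definition cycle_length := {l : nat | 0 < l}.

Notation sum_of_cycles := {mset cycle_length}%mset.

(* Only used at l > 0 (the value at l = 0 is the irrelevant 1). *)
Definition to_length (l : nat) : cycle_length :=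
  insubd (exist (fun k => is_true (0 < k)) 1 isT) l.

(* The disjoint union of n copies of C_l. *)
Definition cycles (n l : nat) : sum_of_cycles := msetn n (to_length l).

Definition C1 : sum_of_cycles := cycles 1 1.

(* Distributive product with C_a C_b = gcd(a, b) C_lcm(a, b). *)
Definition scmul (A B : sum_of_cycles) : sum_of_cycles :=
  \big[msetD/mset0]_(a <- A) \big[msetD/mset0]_(b <- B)
    cycles (gcdn (val a) (val b)) (lcmn (val a) (val b)).

Definition irreducible_sum (X : sum_of_cycles) : Prop :=
  forall A B : sum_of_cycles, X = scmul A B -> A = C1 \/ B = C1.

Definition irreducible_factorization
    (X : sum_of_cycles) (F : {mset sum_of_cycles}%mset) : Prop :=
  (forall A : sum_of_cycles, A \in F -> irreducible_sum A /\ A <> C1) /\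
  \big[scmul/C1]_(A <- F) A = X.

(* [fset_set] returns the empty set on infinite sets, so a positive lower bound
   on this number also asserts that the set is finite. *)
Definition nb_irreducible_factorizations (X : sum_of_cycles) : nat :=
  #|` fset_set [set F | irreducible_factorization X F]%classic |%fset.

Lemma exists_prime_above m : exists p, (m < p) && prime p.
Proof. by have [p mp pp] := prime_above m; exists p; rewrite mp. Qed.

Definition next_prime (m : nat) : nat := ex_minn (exists_prime_above m).

(* Numbered from 0: 2, 3, 5, ... *)
Definition nth_prime (i : nat) : nat := iter i.+1 next_prime 0.

Definition kth_primorial (k : nat) : nat := \prod_(i < k) nth_prime i.

Definition primorial (n : nat) : Prop :=
  exists k, 1 <= k /\ n = kth_primorial k.

Record digraph := Digraph { vertex : finType; arc : rel vertex }.

Definition digraph_iso (G H : digraph) : Prop :=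
  exists2 h : vertex G -> vertex H, bijective h &
    forall x y, arc (h x) (h y) = arc x y.

Definition disjoint_union (G H : digraph) : digraph :=
  @Digraph (vertex G + vertex H)%type (fun x y =>
    match x, y with
    | inl x, inl y => arc x y
    | inr x, inr y => arc x y
    | _, _ => false
    end).

Definition direct_product (G H : digraph) : digraph :=
  @Digraph (vertex G * vertex H)%type
    (fun x y => arc x.1 y.1 && arc x.2 y.2).

Definition nth_length (X : sum_of_cycles) (i : 'I_(size X)) : nat :=
  val (tnth (in_tuple X) i).

(* One directed cycle on {0, ..., l-1} for each occurrence of a length l. *)
Definition digraph_of (X : sum_of_cycles) : digraph :=
  @Digraph {i : 'I_(size X) & 'I_(nth_length i)} (fun x y =>
    (tag x == tag y) &&
    (val (tagged y) == (val (tagged x)).+1 %% nth_length (tag x))).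

(* The number of closed walks of length k, for a functional digraph. *)
Definition nb_fix (V : finType) (f : V -> V) (k : nat) : nat :=
  #|[pred x | iter k f x == x]|.

Definition mark (X : sum_of_cycles) (k : nat) : nat :=
  \sum_(a <- X) (if val a %| k then val a else 0).

Definition functional (G : digraph) (f : vertex G -> vertex G) : Prop :=
  forall x y, arc x y = (f x == y).

Lemma val_to_length l : 0 < l -> val (to_length l) = l.
Proof. by move=> l0; rewrite insubdK. Qed.

Lemma to_lengthK (a : cycle_length) : to_length (val a) = a.
Proof. by apply: val_inj; rewrite val_to_length // (valP a). Qed.

Lemma sum_msetE (X : sum_of_cycles) (F : cycle_length -> nat) (s : seq _) :
  {subset X <= s} -> uniq s ->
  \sum_(a <- X) F a = \sum_(a <- s) X a * F a.
Proof.
move=> sXs us.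
transitivity (\sum_(a <- X) \sum_(b <- s | b == a) F b).
  apply: eq_big_seq => a /sXs as_; rewrite big_mkcond (bigD1_seq a) //= eqxx.
  by rewrite big1 ?addn0 // => b /negbTE->.
rewrite (exchange_big_dep predT) //=; apply: eq_bigr => b _.
rewrite big_const_seq iter_addn_0 mulnC -count_mem_mset.
by congr (_ * _); apply: eq_count => a; rewrite /= eq_sym.
Qed.

Lemma sum_msetD (A B : sum_of_cycles) (F : cycle_length -> nat) :
  \sum_(a <- (A `+` B)%mset) F a = \sum_(a <- A) F a + \sum_(a <- B) F a.
Proof.
rewrite -big_cat; apply: perm_big; apply/allP => a _ /=.
by rewrite count_cat !count_mem_mset msetE2.
Qed.

Lemma mark_add A B k : mark (A `+` B)%mset k = mark A k + mark B k.
Proof. exact: sum_msetD. Qed.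

Lemma mark_cycles n l k : 0 < l ->
  mark (cycles n l) k = n * (if l %| k then l else 0).
Proof.
move=> l0; rewrite /mark /cycles enum_msetn big_nseq.
by rewrite val_to_length // iter_addn_0 mulnC.
Qed.

Lemma mark_big (s : seq cycle_length) (F : cycle_length -> sum_of_cycles) k :
  mark (\big[msetD/mset0]_(a <- s) F a) k = \sum_(a <- s) mark (F a) k.
Proof.
elim: s => [|a s IH]; last by rewrite !big_cons mark_add IH.
by rewrite !big_nil /mark enum_mset0 big_nil.
Qed.

Lemma mark_mul A B k : mark (scmul A B) k = mark A k * mark B k.
Proof.
rewrite /scmul mark_big {2}/mark big_distrl; apply: eq_bigr => a _ /=.
rewrite mark_big /mark big_distrr; apply: eq_bigr => b _ /=.
have a0 := valP a; have b0 := valP b.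
rewrite -/(mark _ _) mark_cycles ?lcmn_gt0 ?a0 // dvdn_lcm.
case: (val a %| k); case: (val b %| k); rewrite ?muln0 //=.
by rewrite mulnC muln_lcm_gcd.
Qed.

Lemma mark_inj A B : (forall k, mark A k = mark B k) -> A = B.
Proof.
move=> eqm; apply/msetP => a.
have [m] := ubnP (val a); elim: m => // m IH in a *; rewrite ltnS => am.
have a0 := valP a.
set s := undup (a :: A ++ B).
have us : uniq s by apply: undup_uniq.
have sA : {subset A <= s}.
  by move=> x xA; rewrite mem_undup inE mem_cat xA orbT.
have sB : {subset B <= s}.
  by move=> x xB; rewrite mem_undup inE mem_cat xB !orbT.
have as_ : a \in s by rewrite mem_undup inE eqxx.
have := eqm (val a); rewrite /mark (sum_msetE _ sA us) (sum_msetE _ sB us).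
rewrite !(bigD1_seq a) //= dvdnn.
rewrite (eq_bigr (fun x => B x * (if val x %| val a then val x else 0))).
  by move=> /addIn/eqP; rewrite eqn_pmul2r // => /eqP.
move=> x xa; case: ifP => [xda|_]; last by rewrite !muln0.
rewrite IH //; apply: leq_trans am; rewrite ltn_neqAle dvdn_leq // andbT.
by apply: contra xa => /eqP/val_inj->.
Qed.

Lemma scmulC : commutative scmul.
Proof. by move=> A B; apply: mark_inj => k; rewrite !mark_mul mulnC. Qed.

Lemma scmulA : associative scmul.
Proof. by move=> A B C; apply: mark_inj => k; rewrite !mark_mul mulnA. Qed.

Lemma scmul1 : left_id C1 scmul.
Proof.
by move=> A; apply: mark_inj => k; rewrite mark_mul mark_cycles // dvd1n !mul1n.
Qed.

HB.instance Definition _ :=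
  Monoid.isComLaw.Build sum_of_cycles C1 scmul scmulA scmulC scmul1.

Lemma digraph_iso_sym G H : digraph_iso G H -> digraph_iso H G.
Proof.
move=> [h [h' hK h'K] arch]; exists h'; first by exists h.
by move=> x y; rewrite -arch !h'K.
Qed.

Lemma digraph_iso_trans G H K :
  digraph_iso G H -> digraph_iso H K -> digraph_iso G K.
Proof.
move=> [h hb arch] [g gb arcg]; exists (g \o h); first exact: bij_comp.
by move=> x y; rewrite /= arcg arch.
Qed.

Lemma nb_fix_iso G H f g k : digraph_iso G H ->
  @functional G f -> @functional H g -> nb_fix f k = nb_fix g k.
Proof.
move=> [h hb arch] Gf Hg.
have hi := bij_inj hb.
have hfg x : h (f x) = g (h x).
  by apply/eqP; rewrite eq_sym -Hg arch Gf.
have hk x : h (iter k f x) = iter k g (h x).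
  by elim: k => //= k <-; rewrite hfg.
have -> : nb_fix f k = #|[pred x | h x \in [pred y | iter k g y == y]]|.
  by apply: eq_card => x; rewrite !inE -hk (inj_eq hi).
have [h' hK h'K] := hb.
rewrite -(fintype.card_image hi); apply: eq_card => y.
by rewrite -(h'K y) (fintype.mem_image hi).
Qed.

Definition succ_of X (x : vertex (digraph_of X)) : vertex (digraph_of X).
Proof.
exists (tag x); exists ((val (tagged x)).+1 %% nth_length (tag x)).
by rewrite ltn_mod; apply: leq_ltn_trans (ltn_ord (tagged x)).
Defined.

Lemma succ_ofP X : functional (@succ_of X).
Proof.
move=> [i u] [j v]; rewrite /=; case: eqVneq => /= [eij|neij].
  case: _ / eij in v *.
  by rewrite /succ_of /= eq_Tagged /= -val_eqE /= eq_sym.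
by apply/esym/negbTE; apply: contra neij => /eqP/(congr1 tag)/= ->.
Qed.

Definition vtx (X : sum_of_cycles) (i : 'I_(size X)) (u : 'I_(nth_length i)) :
  vertex (digraph_of X) := Tagged (fun i => 'I_(nth_length i)) u.

Lemma eq_vtx (X : sum_of_cycles) (i : 'I_(size X)) (u v : 'I_(nth_length i)) :
  (vtx u == vtx v) = (u == v).
Proof. exact: eq_Tagged. Qed.

Lemma nb_fix_digraph_of X k : nb_fix (@succ_of X) k = mark X k.
Proof.
have itE (x : vertex (digraph_of X)) : iter k (@succ_of X) x == x
    = (nth_length (tag x) %| k).
  case: x => i u; rewrite -/(vtx u) /=.
  have -> : iter k (@succ_of X) (vtx u) == vtx u
      = ((u + k) %% nth_length i == u).
    have: exists2 v : 'I_(nth_length i),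
        iter k (@succ_of X) (vtx u) = vtx v
        & val v = (u + k) %% nth_length i.
      elim: k => [|k [v e ev]].
        by exists u => //; rewrite addn0 modn_small.
      exists (tagged (succ_of (vtx v))); first by rewrite iterS; refine (congr1 (@succ_of X) e).
      by rewrite /= ev -addn1 modnDml addn1 addnS.
    move=> [v e <-]; apply: etrans (congr1 (eq_op^~ (vtx u)) e) _.
    by rewrite eq_vtx -val_eqE.
  by rewrite -{2}[u : nat](modn_small (ltn_ord u)) -{2}[u : nat]addn0
    eqn_modDl mod0n.
rewrite /nb_fix -sum1_card big_mkcond /=.
rewrite (eq_bigr (fun x : vertex (digraph_of X) =>
  if nth_length (tag x) %| k then 1 else 0)); last first.
  by move=> x _; rewrite inE itE.
rewrite /mark [RHS]big_tnth.
transitivity (\sum_(i < size X) \sum_(u < nth_length i)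
    if nth_length i %| k then 1 else 0).
  by rewrite sig_big_dep.
apply: eq_bigr => i _; rewrite sum_nat_const card_ord /nth_length.
by case: ifP; rewrite ?muln1 ?muln0.
Qed.

Lemma succ_of_inj X : injective (@succ_of X).
Proof.
move=> [i u] [j v] e; have /= eij := congr1 tag e.
case: _ / eij in v e *; congr existT; apply: val_inj.
have : val (tagged (succ_of (vtx u))) == val (tagged (succ_of (vtx v))).
  by rewrite -[succ_of (vtx u)]/(succ_of _) e.
rewrite /=.
rewrite -[(val u).+1]addn1 -[(val v).+1]addn1 eqn_modDr.
by rewrite !modn_small ?(ltn_ord u) ?(ltn_ord v) // => /eqP.
Qed.

Lemma perm_eq_map_inv (T T' : eqType) (g : T -> T') s t :
  perm_eq s (map g t) -> exists2 t', perm_eq t' t & s = map g t'.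
Proof.
case: t => [|x t] pst; first by exists [::] => //; apply/perm_nilP.
have /(perm_iotaP (g x))[Is pI ->] := pst.
exists (map (nth x (x :: t)) Is).
  apply/(perm_iotaP x); exists Is => //.
  by rewrite size_map in pI.
rewrite -map_comp; apply/eq_in_map => i.
rewrite (perm_mem pI) mem_iota /= size_map add0n => it.
by rewrite -[g x :: _]/(map g (x :: t)) (nth_map x).
Qed.

Lemma functional_cycles G f : @functional G f -> injective f ->
  exists X, digraph_iso G (digraph_of X).
Proof.
move=> Gf fi; have fs := fconnect_sym fi.
pose len x := to_length (order f x).
have lenE x : val (len x) = order f x by rewrite val_to_length ?order_gt0.
pose X : sum_of_cycles := seq_mset (map len (enum (froots f))).
have [t pt Xt] := perm_eq_map_inv (perm_eq_seq_mset (map len (enum (froots f)))).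
rewrite -/X in Xt.
have ut : uniq t by rewrite (perm_uniq pt) enum_uniq.
have mt x : (x \in t) = froots f x by rewrite (perm_mem pt) mem_enum.
have szt : size t == size X by rewrite Xt size_map.
pose r := tnth (Tuple szt).
have rE i : nth_length i = order f (r i).
  rewrite -lenE /nth_length (tnth_nth (to_length 1)) /=.
  have -> : nth (to_length 1) X i = nth (to_length 1) (map len t) i by rewrite -Xt.
  rewrite (nth_map (r i)) ?(eqP szt) //.
  by rewrite /r {2}(tnth_nth (r i)).
have r_root i : froot f (r i) = r i.
  by apply/eqP; rewrite -[_ == _]/(froots f (r i)) -mt (mem_tnth i (Tuple szt)).
have r_inj : injective r by apply/tuple_uniqP.
pose h (x : vertex (digraph_of X)) : vertex G :=
  iter (val (tagged x)) f (r (tag x)).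
have h_root x : froot f (h x) = r (tag x).
  rewrite -r_root; apply/eqP; rewrite (root_connect fs) fs.
  exact: fconnect_iter.
have hi : injective h.
  move=> [i u] [j v] e; have := congr1 (froot f) e.
  rewrite !h_root /= => /r_inj eij; case: _ / eij in v e *.
  congr existT; apply: val_inj => /=.
  rewrite -(@findex_iter _ f (r i) u) -?rE //.
  by rewrite -(@findex_iter _ f (r i) v) -?rE //; congr findex.
have hb : bijective h.
  apply: (inj_card_bij hi); rewrite -(card_codom hi).
  apply: subset_leq_card; apply/fintype.subsetP => y _; apply/codomP.
  have : froot f y \in Tuple szt by rewrite -[_ \in _]/(_ \in t) mt; apply: roots_root.
  move=> /tnthP[i yi].
  have cy : fconnect f (r i) y by rewrite fs /r -yi connect_root.
  have lt : findex f (r i) y < nth_length i by rewrite rE findex_max.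
  by exists (vtx (Ordinal lt)); rewrite /h /= iter_findex.
have hS x : h (succ_of x) = f (h x).
  case: x => i u; rewrite /h /= -iterS.
  have := ltn_ord u; rewrite leq_eqVlt => /orP[/eqP ul|ul].
    by rewrite ul modnn rE iter_order.
  by rewrite modn_small.
exists X; apply: digraph_iso_sym; exists h => // x y.
by rewrite Gf succ_ofP -hS (inj_eq hi).
Qed.

(* The digraphs represented are those in which every vertex has exactly one
   out-neighbour and one in-neighbour. *)
Lemma sum_of_cyclesP G :
  (exists X, digraph_iso G (digraph_of X)) <->
  (exists2 f, injective f & @functional G f).
Proof.
split=> [[X [h [h' hK h'K] arch]]|[f fi Gf]]; last exact: functional_cycles fi.
exists (h' \o @succ_of X \o h).
  by apply: inj_comp (can_inj hK); apply: inj_comp (can_inj h'K) (@succ_of_inj X).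
by move=> x y; rewrite -arch succ_ofP (can2_eq h'K hK).
Qed.

Lemma digraph_of_inj A B :
  digraph_iso (digraph_of A) (digraph_of B) -> A = B.
Proof.
move=> isoAB; apply: mark_inj => k; rewrite -!nb_fix_digraph_of.
by apply: (nb_fix_iso k isoAB); apply: succ_ofP.
Qed.

Lemma digraph_of_marks G f X : @functional G f -> injective f ->
  (forall k, nb_fix f k = mark X k) -> digraph_iso (digraph_of X) G.
Proof.
move=> Gf fi fX; have [Y isoY] := functional_cycles Gf fi.
suff -> : X = Y by apply: digraph_iso_sym.
apply: mark_inj => k; rewrite -fX -nb_fix_digraph_of.
by apply: (nb_fix_iso k isoY) => //; apply: succ_ofP.
Qed.

Lemma digraph_of_add A B :
  digraph_iso (digraph_of (A `+` B)%mset)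
    (disjoint_union (digraph_of A) (digraph_of B)).
Proof.
pose f (x : vertex (disjoint_union (digraph_of A) (digraph_of B))) :
    vertex (disjoint_union (digraph_of A) (digraph_of B)) :=
  match x with inl y => inl (succ_of y) | inr z => inr (succ_of z) end.
apply: (@digraph_of_marks _ f).
- by move=> [x|x] [y|y] //; rewrite [LHS]succ_ofP.
- move=> [x|x] [y|y] // e; congr (_ _); apply: succ_of_inj.
    exact: (@inl_inj _ (vertex (digraph_of B)) _ _ e).
  exact: (@inr_inj (vertex (digraph_of A)) _ _ _ e).
- move=> k; rewrite mark_add -!nb_fix_digraph_of /nb_fix -!sum1_card.
  have itl x : iter k f (inl x) = inl (iter k (@succ_of A) x).
    by elim: (k) => //= m ->.
  have itr x : iter k f (inr x) = inr (iter k (@succ_of B) x).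
    by elim: (k) => //= m ->.
  rewrite big_sumType /=; congr (_ + _); apply: eq_bigl => x; rewrite !inE.
    by rewrite itl.
  by rewrite itr.
Qed.

Lemma digraph_of_mul A B :
  digraph_iso (digraph_of (scmul A B))
    (direct_product (digraph_of A) (digraph_of B)).
Proof.
pose f (x : vertex (direct_product (digraph_of A) (digraph_of B))) :
    vertex (direct_product (digraph_of A) (digraph_of B)) :=
  (succ_of x.1, succ_of x.2).
apply: (@digraph_of_marks _ f).
- by move=> [x x'] [y y']; rewrite xpair_eqE -!succ_ofP.
- by move=> [x x'] [y y'] e;
  congr pair; apply: succ_of_inj; [exact (congr1 fst e) | exact (congr1 snd e)].
- move=> k; rewrite mark_mul -!nb_fix_digraph_of /nb_fix -cardX.
  apply: eq_card => -[x y]; rewrite !inE /=.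
  have -> : iter k f (x, y) = (iter k (@succ_of A) x, iter k (@succ_of B) y).
    by elim: (k) => //= m ->.
  by rewrite xpair_eqE.
Qed.

(* Main.v *)
Require Import Defs.
From HB Require Import structures.
From mathcomp Require Import all_boot all_order all_algebra finmap multiset.
From mathcomp Require Import boolp classical_sets cardinality.
From mathcomp Require Import reals sequences exp.
From mathcomp Require Import zify ring lra.
Import Order.TTheory GRing.Theory Num.Theory.

Set Implicit Arguments.
Unset Strict Implicit.
Unset Printing Implicit Defensive.

Local Open Scope nat_scope.

(** Let n = P_k be the product of the first k primes.  If the cycle lengths of A
all divide n, then A C_n = |A| C_n, where |A| is the number of vertices of A
(lemma [scmul_absorb]).  Hence every A with n vertices and all lengths dividing
n gives a factorization of n C_n: factor A, then append one fixed factorization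
of C_n.  Cancelling the latter and multiplying what is left gives A back, so
n C_n has at least as many irreducible factorizations as there are such A.

A simple family of these A is large enough.  The sum of the divisors of P_(k-1)
is at most P_k, by induction, because (q + 1) is at most the prime that follows
q (lemma [primorial_divisors]).  So each set of divisors d > 1 of P_(k-1) yields
one A: a cycle C_d for each d in the set, completed to n vertices by copies of
C_1.  As P_(k-1) has 2^(k-1) divisors, there are at least 2^(2^(k-1) - 1)
irreducible factorizations.  The count is meaningful because the set of
factorizations is finite: vertex counts multiply, and a factor other than C_1
has at least two vertices.

It remains to compare 2^(2^(k-1) - 1) with n^(2^x), where L = ln n and
x = L / ((1 + eps) ln L).  Up to terms of size O(ln L), this asks for x <= k.
Let p be the k-th prime, so that L <= k ln p.  If ln p <= (1 + eps') ln L for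
some eps' < eps, then x <= k (1 + eps') / (1 + eps), which falls short of k by a
positive proportion of k and so leaves room for the O(ln L) = O(ln k)
([log_count_bound]).  Chebyshev's argument bounds ln p in this way: the prime
factorization of the binomial coefficient C(2m, m), for m = p / 2 rounded down,
shows 2^m <= p^k ([exp2_half_le]), so that p = O(k ln p) = O(L ln p) and
ln p <= (1 + o(1)) ln L. *)

(** * Vertex counts *)

Definition nb_vertices (X : sum_of_cycles) : nat := \sum_(a <- X) val a.

Lemma nb_vertices_add A B :
  nb_vertices (A `+` B)%mset = nb_vertices A + nb_vertices B.
Proof. exact: sum_msetD. Qed.

Lemma nb_vertices_cycles n l : 0 < l -> nb_vertices (cycles n l) = n * l.
Proof.
move=> l0; rewrite /nb_vertices /cycles enum_msetn big_nseq.
by rewrite val_to_length // iter_addn_0 mulnC.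
Qed.

Lemma nb_vertices_big (I : Type) (s : seq I) (P : pred I)
    (F : I -> sum_of_cycles) :
  nb_vertices (\big[msetD/mset0]_(i <- s | P i) F i) =
    \sum_(i <- s | P i) nb_vertices (F i).
Proof.
apply: (big_morph nb_vertices nb_vertices_add).
by rewrite /nb_vertices enum_mset0 big_nil.
Qed.

(** Holds because gcd(a, b) lcm(a, b) = a b. *)
Lemma nb_vertices_mul A B :
  nb_vertices (scmul A B) = nb_vertices A * nb_vertices B.
Proof.
rewrite /scmul nb_vertices_big {2}/nb_vertices big_distrl.
apply: eq_bigr => a _ /=.
rewrite nb_vertices_big /nb_vertices big_distrr; apply: eq_bigr => b _ /=.
have a0 := valP a; have b0 := valP b.
rewrite -/(nb_vertices _) nb_vertices_cycles ?lcmn_gt0 ?a0 //.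
by rewrite mulnC muln_lcm_gcd.
Qed.

Lemma nb_vertices_prod (F : {mset sum_of_cycles}%mset) :
  nb_vertices (\big[scmul/C1]_(A <- F) A) = \prod_(A <- F) nb_vertices A.
Proof.
by apply: (big_morph nb_vertices nb_vertices_mul); rewrite nb_vertices_cycles.
Qed.

(** When every cycle length divides [k], all vertices lie on closed walks of
length [k], which are what [mark] counts. *)
Lemma nb_vertices_mark X k :
  (forall a, a \in X -> val a %| k) -> mark X k = nb_vertices X.
Proof.
by move=> Xk; apply: eq_big_seq => a aX; rewrite (Xk _ aX).
Qed.

Lemma size_le_nb_vertices (X : sum_of_cycles) : size X <= nb_vertices X.
Proof. by rewrite -sum1_size; apply: leq_sum => a _; apply: valP. Qed.

Lemma length_le_nb_vertices (X : sum_of_cycles) a :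
  a \in X -> val a <= nb_vertices X.
Proof. by move=> aX; rewrite /nb_vertices (big_rem a) //= leq_addr. Qed.

Lemma nb_vertices_eq1 X : nb_vertices X = 1 -> X = C1.
Proof.
move=> X1; apply/eqP; rewrite -(seq_mset_id X) -(seq_mset_id C1); apply/eqP.
apply/eq_seq_msetP; rewrite /C1 /cycles enum_msetn /=.
have := size_le_nb_vertices X; move: X1; rewrite /nb_vertices.
case: (enum_mset X) => [|a [|b s]] /=; first by rewrite big_nil.
  rewrite big_seq1 => a1 _; suff -> : a = to_length 1 by [].
  by rewrite -(to_lengthK a); congr to_length.
by move=> ->.
Qed.

(** * Existence of irreducible factorizations *)

Lemma irreducible_factorizationD X Y F G :
  irreducible_factorization X F -> irreducible_factorization Y G ->
  irreducible_factorization (scmul X Y) (F `+` G)%mset.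
Proof.
move=> [irF XE] [irG YE]; split=> [A|].
  by rewrite in_msetD => /orP[/irF|/irG].
rewrite -XE -YE -big_cat; apply: perm_big; apply/allP => A _ /=.
by rewrite count_cat !count_mem_mset msetE2.
Qed.

(** Splitting a reducible sum into two factors other than [C1] strictly
decreases the number of vertices.  The empty sum has to be excluded: it is its
own product with anything. *)
Lemma exists_irreducible_factorization X :
  0 < nb_vertices X -> exists F, irreducible_factorization X F.
Proof.
have [m] := ubnP (nb_vertices X); elim: m => // m IH in X *.
rewrite ltnS => Xm X0.
have [->|X1] := pselect (X = C1).
  exists mset0; split=> [A|]; first by rewrite in_mset0.
  by rewrite enum_mset0 big_nil.
have [irX|] := pselect (irreducible_sum X).
  exists (msetn 1 X); split=> [A|]; last by rewrite enum_msetn /= big_seq1.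
  by rewrite in_mset1 => /eqP->.
move=> /existsNP[A /existsNP[B]] /not_implyP[XE] /not_orP[A1 B1].
have [A0 B0] : 0 < nb_vertices A /\ 0 < nb_vertices B.
  by apply/andP; rewrite -muln_gt0 -nb_vertices_mul -XE.
have gt1 Y : 0 < nb_vertices Y -> Y <> C1 -> 1 < nb_vertices Y.
  move=> Y0 Y1; rewrite ltn_neqAle Y0 andbT eq_sym.
  by apply/eqP => /nb_vertices_eq1.
have [|F fF] := IH A _ A0.
  by apply: leq_trans Xm; rewrite XE nb_vertices_mul ltn_Pmulr // gt1.
have [|G fG] := IH B _ B0.
  by apply: leq_trans Xm; rewrite XE nb_vertices_mul ltn_Pmull // gt1.
by exists (F `+` G)%mset; rewrite XE; apply: irreducible_factorizationD.
Qed.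

(** * Finiteness of the set of irreducible factorizations *)

Lemma finite_bounded_seqs (T : choiceType) (S : set T) n :
  finite_set S ->
  finite_set [set s : seq T | size s <= n /\ forall x, x \in s -> S x]%classic.
Proof.
move=> finS; elim: n => [|n IH].
  apply: (@sub_finite_set _ _ [set [::]]%classic) => // -[|x s] [] //.
apply: (@sub_finite_set _ _ ([set [::]] `|` [set x :: s | x in S &
  s in [set s | size s <= n /\ forall x, x \in s -> S x]])%classic).
  move=> [|x s] /= [sn Ss]; [by left|right].
  exists x; first by apply: Ss; rewrite inE eqxx.
  by exists s => //; split=> // y ys; apply: Ss; rewrite inE ys orbT.
by rewrite finite_setU; split => //; apply: finite_image2.
Qed.

(** A multiset is determined by any enumeration of it, so finiteness is
inherited from the bounded sequences over [S]. *)
Lemma finite_bounded_msets (T : choiceType) (S : set T) n :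
  finite_set S ->
  finite_set [set X : {mset T}%mset | size X <= n /\
                forall x, x \in X -> S x]%classic.
Proof.
move=> finS; have := finite_image (@seq_mset T) (finite_bounded_seqs n finS).
apply: sub_finite_set => X /= [Xn XS]; exists (enum_mset X) => //.
exact: seq_mset_id.
Qed.

Lemma finite_sums_le_nb_vertices n :
  finite_set [set X : sum_of_cycles | nb_vertices X <= n]%classic.
Proof.
have fin : finite_set [set a : cycle_length | val a <= n]%classic.
  have := finite_image to_length (finite_II n.+1); apply: sub_finite_set.
  by move=> a /= an; exists (val a); [exact: an|exact: to_lengthK].
have := finite_bounded_msets n fin; apply: sub_finite_set => X /= Xn.
split=> [|a /length_le_nb_vertices aX].
  exact: leq_trans (size_le_nb_vertices X) Xn.
exact: leq_trans aX Xn.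
Qed.

(** With all factors at least 2, a product dominates both the number of its
factors and each of them. *)
Lemma leq_prod_gt1 (s : seq sum_of_cycles) :
  (forall A, A \in s -> 1 < nb_vertices A) ->
  size s <= \prod_(A <- s) nb_vertices A /\
  forall A, A \in s -> nb_vertices A <= \prod_(B <- s) nb_vertices B.
Proof.
elim: s => [//|A s IH] gt1.
have A1 : 1 < nb_vertices A by apply: gt1; rewrite inE eqxx.
have gt1s B : B \in s -> 1 < nb_vertices B.
  by move=> Bs; apply: gt1; rewrite inE Bs orbT.
have [sn sle] := IH gt1s; rewrite big_cons /=.
have s0 : 0 < \prod_(B <- s) nb_vertices B.
  by rewrite big_seq prodn_cond_gt0 // => B /gt1s/ltnW.
split=> [|B]; first by apply: leq_ltn_trans sn _; rewrite ltn_Pmull.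
rewrite inE => /orP[/eqP->|/sle Bs]; first by rewrite leq_pmulr.
by rewrite (leq_trans Bs) // leq_pmull // ltnW.
Qed.

Lemma finite_irreducible_factorizations X :
  0 < nb_vertices X ->
  finite_set [set F | irreducible_factorization X F]%classic.
Proof.
move=> X0.
have := finite_bounded_msets (nb_vertices X)
  (finite_sums_le_nb_vertices (nb_vertices X)).
apply: sub_finite_set => F /= [irF XE].
rewrite -XE nb_vertices_prod; apply: leq_prod_gt1 => A AF.
have [_ A1] := irF A AF.
rewrite ltn_neqAle eq_sym; apply/andP; split.
  by apply/eqP => /nb_vertices_eq1.
rewrite lt0n; apply: contraTneq X0 => A0.
by rewrite -XE nb_vertices_prod (big_rem A) //= A0.
Qed.

(** * Factorizations from sums with n vertices *)

(** For a divisor [a] of [n], C_a C_n = gcd(a, n) C_lcm(a, n) = a C_n. *)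
Lemma scmul_absorb X n : 0 < n -> (forall a, a \in X -> val a %| n) ->
  scmul X (cycles 1 n) = cycles (nb_vertices X) n.
Proof.
move=> n0 Xn; apply: mark_inj => k; rewrite mark_mul !mark_cycles // mul1n.
case: ifP => [nk|_]; last by rewrite !muln0.
by rewrite nb_vertices_mark // => a /Xn /dvdn_trans; apply.
Qed.

(** The factorization attached to [t] joins one of [A t] to a factorization of
C_n that does not depend on [t]; the former is recovered by subtracting the
latter, hence so is its product [A t]. *)
Lemma leq_nb_irreducible_factorizations (T : finType)
    (A : T -> sum_of_cycles) n :
  0 < n -> injective A -> (forall t, nb_vertices (A t) = n) ->
  (forall t a, a \in A t -> val a %| n) ->
  #|T| <= nb_irreducible_factorizations (cycles n n).
Proof.
move=> n0 injA An divA.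
have [G0 fG0] : exists G, irreducible_factorization (cycles 1 n) G.
  by apply: exists_irreducible_factorization; rewrite nb_vertices_cycles ?mul1n.
have /choice[F fF] : forall t, exists F, irreducible_factorization (A t) F.
  by move=> t; apply: exists_irreducible_factorization; rewrite An.
pose g t := (F t `+` G0)%mset.
have gf t : irreducible_factorization (cycles n n) (g t).
  have := irreducible_factorizationD (fF t) fG0.
  by rewrite scmul_absorb ?An //; apply: divA.
have injg : injective g.
  move=> t u /msetP gtu; apply: injA; rewrite -(fF t).2 -(fF u).2.
  suff -> : F t = F u by [].
  by apply/msetP => x; have := gtu x; rewrite !msetE2 => /addIn.
have finX : finite_set
    [set F | irreducible_factorization (cycles n n) F]%classic.
  apply: finite_irreducible_factorizations.
  by rewrite nb_vertices_cycles ?muln_gt0 ?n0.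
rewrite /nb_irreducible_factorizations cardE -(size_map g).
apply: uniq_leq_size; first by rewrite map_inj_uniq ?enum_uniq.
move=> _ /mapP[t _ ->]; rewrite -[_ \in _]/(_ \in fset_set _).
by rewrite in_fset_set // inE; apply: gf.
Qed.

Section DistinctLengths.
Variables (n : nat) (s : seq nat).
Hypotheses (us : uniq s) (s_gt1 : forall d, d \in s -> 1 < d).
Hypotheses (s_dvd : forall d, d \in s -> d %| n) (sum_s : \sum_(d <- s) d <= n).

Let len (i : 'I_(size s)) := nth 0 s i.

Let len_s i : len i \in s.
Proof. by rewrite mem_nth. Qed.

(** One cycle of each length selected by [t]; the fixed points C_1 bring the
number of vertices to exactly [n]. *)
Definition sum_of_subset (t : {set 'I_(size s)}) : sum_of_cycles :=
  (\big[msetD/mset0]_(i in t) cycles 1 (len i)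
     `+` cycles (n - \sum_(i in t) len i) 1)%mset.

Lemma nb_vertices_sum_of_subset t : nb_vertices (sum_of_subset t) = n.
Proof.
rewrite nb_vertices_add nb_vertices_big nb_vertices_cycles // muln1.
rewrite (eq_bigr len) => [|i _]; last first.
  by rewrite nb_vertices_cycles ?mul1n // ltnW ?s_gt1.
rewrite subnKC //; apply: leq_trans sum_s.
by rewrite (big_nth 0) big_mkord [leqRHS](bigID (mem t)) leq_addr.
Qed.

(** The lengths in [s] are distinct and exceed 1, so no two of them are confused
with each other or with the filler. *)
Lemma sum_of_subset_mult t i :
  sum_of_subset t (to_length (len i)) = (i \in t).
Proof.
have l0 j : 0 < len j by apply: ltnW; apply: s_gt1.
rewrite /sum_of_subset msetE2 [X in _ + X]msetnE.
rewrite ifN ?addn0; last first.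
  apply/eqP => /(congr1 val); rewrite !val_to_length // => l1.
  by have := s_gt1 (len_s i); rewrite l1.
rewrite (big_morph (fun X : sum_of_cycles => X _)
  (id1 := 0) (op1 := addn)) => [|A B|]; [|by rewrite msetE2|by rewrite mset0E].
rewrite (eq_bigr (fun j => (j == i) : nat)) => [|j _].
  by rewrite big_mkcond (bigD1 i) //= eqxx big1 ?addn0; [case: ifP|
    move=> j /negbTE->; case: ifP].
rewrite msetnE -val_eqE !val_to_length //.
rewrite /len nth_uniq // eq_sym -val_eqE /=.
by case: (_ == _).
Qed.

Lemma sum_of_subset_inj : injective sum_of_subset.
Proof.
move=> t u /msetP tu; apply/setP => i.
have := tu (to_length (len i)); rewrite !sum_of_subset_mult.
by do 2 case: (_ \in _).
Qed.

Lemma sum_of_subset_dvd t a : a \in sum_of_subset t -> val a %| n.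
Proof.
rewrite in_msetD => /orP[|]; last first.
  by rewrite in_msetn => /andP[_ /eqP->]; rewrite val_to_length // dvd1n.
elim/big_rec: _ => [|i X _ IH]; first by rewrite in_mset0.
rewrite in_msetD => /orP[|//]; rewrite in_msetn => /andP[_ /eqP->].
by rewrite val_to_length ?s_dvd // ltnW ?s_gt1.
Qed.

Lemma exp2_leq_nb_irreducible_factorizations : 0 < n ->
  2 ^ size s <= nb_irreducible_factorizations (cycles n n).
Proof.
move=> n0.
have := leq_nb_irreducible_factorizations n0 sum_of_subset_inj
  nb_vertices_sum_of_subset sum_of_subset_dvd.
by rewrite -cardsT -powersetT card_powerset cardsT card_ord.
Qed.
End DistinctLengths.

(** * Primorial numbers *)

Lemma next_prime_gt m : m < next_prime m.
Proof. by rewrite /next_prime; case: ex_minnP => p /andP[]. Qed.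

Lemma prime_next_prime m : prime (next_prime m).
Proof. by rewrite /next_prime; case: ex_minnP => p /andP[]. Qed.

Lemma prime_nth_prime i : prime (nth_prime i).
Proof. exact: prime_next_prime. Qed.

Lemma nth_prime_ltS i : nth_prime i < nth_prime i.+1.
Proof. exact: next_prime_gt. Qed.

Lemma nth_prime_lt i j : i < j -> nth_prime i < nth_prime j.
Proof. exact: (homo_ltn ltn_trans nth_prime_ltS). Qed.

Lemma nth_prime_le i j : i <= j -> nth_prime i <= nth_prime j.
Proof. by rewrite leq_eqVlt => /predU1P[->//|/nth_prime_lt/ltnW]. Qed.

Lemma nth_prime_gt i : i < nth_prime i.
Proof.
elim: i => [|i IH]; first by rewrite prime_gt0 // prime_nth_prime.
exact: leq_ltn_trans IH (nth_prime_ltS i).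
Qed.

(** Hence at most k + 1 primes are below or equal to [nth_prime k]; this is how
the index [k] enters [exp2_half_le]. *)
Lemma nth_primeP p k : prime p -> p <= nth_prime k ->
  exists2 i, i <= k & p = nth_prime i.
Proof.
move=> pp; elim: k => [|k IH] pk.
  exists 0 => //; apply/eqP; rewrite eqn_leq pk /nth_prime /= /next_prime.
  by case: ex_minnP => q _; apply; rewrite prime_gt0 pp.
have [/IH[i ik ->]|kp] := leqP p (nth_prime k).
  by exists i => //; apply: leqW.
exists k.+1 => //; apply/eqP; rewrite eqn_leq pk /nth_prime /= {1}/next_prime.
by case: ex_minnP => q _; apply; rewrite pp andbT.
Qed.

Lemma kth_primorialS k : kth_primorial k.+1 = kth_primorial k * nth_prime k.
Proof. by rewrite /kth_primorial big_ord_recr. Qed.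

Lemma kth_primorial_gt0 k : 0 < kth_primorial k.
Proof. by rewrite prodn_gt0 // => i; rewrite prime_gt0 // prime_nth_prime. Qed.

Lemma kth_primorial_le j k : j <= k -> kth_primorial j <= kth_primorial k.
Proof.
apply: (homo_leq leqnn leq_trans) => i.
by rewrite kth_primorialS leq_pmulr // prime_gt0 // prime_nth_prime.
Qed.

Lemma exp2_le_kth_primorial k : 2 ^ k <= kth_primorial k.
Proof.
elim: k => [|k IH]; first by rewrite /kth_primorial big_ord0.
by rewrite kth_primorialS expnSr leq_mul // prime_gt1 // prime_nth_prime.
Qed.

Lemma kth_primorial_le_exp k : kth_primorial k.+1 <= nth_prime k ^ k.+1.
Proof.
rewrite -{2}[k.+1]card_ord -prod_nat_const.
by apply: leq_prod => i _; apply: nth_prime_le; rewrite -ltnS.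
Qed.

Lemma nth_prime_ndvd_kth_primorial k : ~~ (nth_prime k %| kth_primorial k).
Proof.
rewrite Euclid_dvd_prod ?prime_nth_prime //.
rewrite big_has_cond /= -all_predC; apply/allP => i _ /=.
rewrite dvdn_prime2 ?prime_nth_prime //.
by rewrite neq_ltn (nth_prime_lt (ltn_ord i)) orbT.
Qed.

(** The list [s] consists of the divisors of P_k other than 1.  Passing from P_k
to P_k q, where [q] is the next prime, replaces 1 + sum(s) by
(1 + sum(s)) (q + 1), and q + 1 is at most the prime after [q]. *)
Lemma primorial_divisors k : exists s : seq nat,
  [/\ uniq s, size s = (2 ^ k).-1, (forall d, d \in s -> 1 < d),
      (forall d, d \in s -> d %| kth_primorial k) &
      \sum_(d <- s) d < kth_primorial k.+1].
Proof.
elim: k => [|k [s [us ss s1 sd sk]]].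
  exists [::]; split=> //.
  by rewrite big_nil kth_primorial_gt0.
have p1 : 1 < nth_prime k by rewrite prime_gt1 // prime_nth_prime.
set p := nth_prime k in p1 *.
have ps x : x \in 1 :: s -> ~~ (p %| x).
  rewrite inE => /predU1P[->|/sd xk].
    by rewrite dvdn1 neq_ltn p1 orbT.
  by apply: contra (nth_prime_ndvd_kth_primorial k) => /dvdn_trans; apply.
exists (s ++ [seq p * x | x <- 1 :: s]); split.
- rewrite cat_uniq us /=; apply/and3P; split.
  + rewrite -[_ || _]/(has (mem s) [seq p * x | x <- 1 :: s]) -all_predC.
    apply/allP => _ /mapP[x _ ->] /=; apply/negP => pxs.
    by have := ps (p * x); rewrite inE pxs orbT dvdn_mulr // => /(_ isT).
  + apply/mapP => -[x xs /eqP]; rewrite eqn_pmul2l ?(ltnW p1) // => /eqP x1.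
    by have := s1 _ xs; rewrite -x1.
  + rewrite map_inj_uniq // => x y /eqP.
    by rewrite eqn_pmul2l ?(ltnW p1) // => /eqP.
- rewrite size_cat size_map /= ss expnS.
  by have := expn_gt0 2 k; lia.
- move=> d; rewrite mem_cat => /orP[/s1//|/mapP[x xs ->]].
  apply: leq_trans p1 _; rewrite leq_pmulr //.
  by move: xs; rewrite inE => /predU1P[->//|/s1/ltnW].
- move=> d; rewrite kth_primorialS mem_cat => /orP[/sd dk|/mapP[x xs ->]].
    exact: dvdn_mulr.
  rewrite mulnC dvdn_mul //.
  by move: xs; rewrite inE => /predU1P[->//|/sd].
rewrite big_cat /= big_cons big_map muln1 -big_distrr /=.
rewrite [kth_primorial k.+2]kth_primorialS.
have := nth_prime_ltS k; rewrite -/p => pk.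
apply: leq_trans (leq_mul sk pk).
rewrite -[X in X <= _]addn1 mulSn mulnS; lia.
Qed.

(** * Chebyshev's lower bound on the number of primes *)

Lemma exp2_le_bin_double m : 2 ^ m <= 'C(m.*2, m).
Proof.
elim: m => // m IH; rewrite doubleS binS expnS mul2n -addnn.
have -> : 'C(m.*2.+1, m.+1) = 'C(m.*2.+1, m).
  by rewrite -[in RHS]bin_sub -addnn ?subSn ?addnK ?leq_addr // leqW ?leq_addr.
by rewrite leq_add // (leq_trans IH) // leq_bin2l.
Qed.

(** Legendre's formula with a range of summation that is common to several
factorials. *)
Lemma logn_fact_bound p n N : prime p -> n <= N ->
  logn p n`! = \sum_(1 <= k < N.+1) n %/ p ^ k.
Proof.
move=> pp nN; rewrite logn_fact // [RHS](@big_cat_nat _ _ _ n.+1) //=.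
rewrite -[LHS]addn0; congr addn; rewrite big_nat big1 // => k /andP[nk _].
by rewrite divn_small // (ltn_trans nk) // ltn_expl // prime_gt1.
Qed.

(** In Legendre's formula the exponent of [p] in C(2m, m) is the sum over k >= 1
of floor(2m / p^k) - 2 floor(m / p^k).  Each term is at most 1, and it vanishes
once p^k > 2m, so the exponent is at most the largest k with p^k <= 2m. *)
Lemma expn_logn_bin_double p m : prime p -> 0 < m ->
  p ^ logn p 'C(m.*2, m) <= m.*2.
Proof.
move=> pp m0; have m2 : m <= m.*2 by rewrite -addnn leq_addr.
have p1 := prime_gt1 pp.
have m20 : 0 < m.*2 by rewrite double_gt0.
apply: leq_trans (@trunc_logP p _ p1 m20).
rewrite leq_exp2l //; set e := trunc_log p m.*2.
have : logn p (m.*2)`! = logn p 'C(m.*2, m) + logn p m`! * 2.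
  have mm : m.*2 - m = m by rewrite -addnn addnK.
  rewrite -(bin_fact m2) mm !lognM ?muln_gt0 ?fact_gt0 ?bin_gt0 //.
  by rewrite addnn muln2.
rewrite !(@logn_fact_bound p _ m.*2) // big_distrl /=.
set S := (X in _ + X) => def_v.
suff : \sum_(1 <= k < m.*2.+1) m.*2 %/ p ^ k <= e + S.
  by rewrite def_v leq_add2r.
have em : e <= m.*2.
  rewrite -(leq_exp2l _ _ p1) (leq_trans (@trunc_logP p _ p1 m20)) //.
  by rewrite ltnW // ltn_expl.
have -> : e = \sum_(1 <= k < m.*2.+1) (k <= e).
  rewrite (@big_cat_nat _ _ _ e.+1) //=.
  rewrite [X in _ = X + _](eq_big_nat _ _ (F2 := fun=> 1)); last first.
    by move=> k /andP[_]; rewrite ltnS => ->.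
  rewrite sum_nat_const_nat muln1 subn1 /= big_nat.
  rewrite big1 ?addn0 // => k /andP[ek _].
  by rewrite leqNgt ek.
rewrite -big_split /= big_nat [leqRHS]big_nat; apply: leq_sum => k /andP[k1 _].
have [ke|ek] := leqP k e.
  have pk0 : 0 < p ^ k by rewrite expn_gt0 prime_gt0.
  rewrite -ltnS ltn_divLR // add1n.
  have := ltn_ceil m pk0; nia.
by rewrite divn_small // (leq_trans (trunc_log_ltn _ p1)) // leq_exp2l.
Qed.

(** C(2m, m) with 2m <= p is a product of at most k + 1 prime powers, each at
most [p], whereas it is at least 2^m. *)
Lemma exp2_half_le k : 2 ^ (nth_prime k)./2 <= nth_prime k ^ k.+1.
Proof.
set p := nth_prime k; pose m := p./2.
apply: leq_trans (exp2_le_bin_double m) _.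
have m2 : m.*2 <= p by rewrite -[leqRHS]odd_double_half leq_addl.
have C0 : 0 < 'C(m.*2, m) by rewrite bin_gt0 -addnn leq_addr.
have m0 : 0 < m by rewrite half_gt0 prime_gt1 // prime_nth_prime.
have factor_le q : q \in primes 'C(m.*2, m) -> q ^ logn q 'C(m.*2, m) <= p.
  rewrite mem_primes => /andP[qp _].
  exact: leq_trans (expn_logn_bin_double qp m0) m2.
have nb : size (primes 'C(m.*2, m)) <= k.+1.
  rewrite -[k.+1](size_iota 0) -[leqRHS](size_map nth_prime).
  apply: uniq_leq_size (primes_uniq _) _ => q qC.
  have qp : prime q by move: qC; rewrite mem_primes => /andP[].
  have [|i ik ->] := @nth_primeP q k qp.
    apply: leq_trans (factor_le q qC).
    by rewrite -{1}[q]expn1 leq_exp2l ?prime_gt1 // logn_gt0.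
  by apply: map_f; rewrite mem_iota.
rewrite [leqLHS]prod_prime_decomp // prime_decompE big_map /=.
apply: (@leq_trans (p ^ size (primes 'C(m.*2, m)))); last first.
  by rewrite leq_pexp2l // prime_gt0 // prime_nth_prime.
rewrite -sum1_size expn_sum big_seq [leqRHS]big_seq.
by apply: leq_prod => q /factor_le; rewrite expn1.
Qed.

(** * Asymptotics *)

Local Open Scope ring_scope.

Section Asymptotics.
Variable R : realType.
Implicit Types (c d eps x y K P n : R).

Lemma ln_le_2sqrt x : 0 < x -> ln x <= 2 * Num.sqrt x.
Proof.
move=> x0; have s0 : 0 < Num.sqrt x by rewrite sqrtr_gt0.
rewrite -{1}(sqr_sqrtr (ltW x0)) lnXn // -[leLHS]mulr_natl.
by rewrite ler_pM2l // ltW // ln_sublinear.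
Qed.

(** Any slope is eventually enough, because 2 sqrt x is sublinear. *)
Lemma ln_le_linear d : 0 < d -> exists T, forall x, T <= x -> ln x <= d * x.
Proof.
move=> d0; exists (4 / d ^+ 2) => x; rewrite ler_pdivrMr ?exprn_gt0 // => Tx.
have x0 : 0 < x by rewrite -(pmulr_lgt0 _ (exprn_gt0 2 d0)) (lt_le_trans _ Tx).
apply: le_trans (ln_le_2sqrt x0) _.
have s0 : 0 < Num.sqrt x by rewrite sqrtr_gt0.
rewrite -[X in d * X](sqr_sqrtr (ltW x0)) expr2 mulrA ler_pM2r //.
rewrite -(@ler_pXn2r _ 2) ?nnegrE ?mulr_ge0 ?(ltW d0) ?(ltW s0) //.
by rewrite exprMn sqr_sqrtr ?(ltW x0) // mulrC; lra.
Qed.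

(** For [c] = ln 2, [P] the K-th prime and L = ln n, the conclusion compares
n^(2^x) with 2^(2^(K-2)) after taking logarithms twice.  The hypotheses give
(c^2 / 4) P <= L ln P, hence (1 - d) ln P <= ln L for large [P], for any fixed
d > 0.  The choice of [d] below makes (1 + eps) (1 - d) = 1 + eps / 2, so that
L / ((1 + eps) ln L) <= K / (1 + eps / 2) = K (1 - eta).  The gap [eta * K]
(times [c]) absorbs ln L = O(ln K) and the constants. *)
Lemma log_count_bound eps c : 0 < eps -> 0 < c -> exists K0, forall K P L,
  K0 <= K -> K <= P -> c * P / 4 <= K * ln P -> c * K <= L -> L <= K * ln P ->
  ln L + L / ((1 + eps) * ln L) * c <= (K - 2) * c + ln c.
Proof.
move=> e0 c0; pose d := eps / (2 * (1 + eps)).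
have d0 : 0 < d by rewrite divr_gt0 // mulr_gt0 // addr_gt0.
have dE : (1 + eps) * (1 - d) = 1 + eps / 2.
  by rewrite /d; field; lra.
have d2 : d <= 2^-1.
  by rewrite /d ler_pdivrMr ?mulr_gt0 ?addr_gt0 //; lra.
have [T1 hT1] : exists T, forall x, T <= x -> ln x <= d / 2 * x.
  by apply: ln_le_linear; rewrite divr_gt0.
pose b := ln (c ^+ 2 / 4).
pose Y := Num.max 1 (Num.max T1 (- b * 2 / d)).
pose eta := eps / 2 / (1 + eps / 2).
have eta0 : 0 < eta by rewrite !divr_gt0 // addr_gt0 // divr_gt0.
have etaE : 1 - eta = (1 + eps / 2)^-1 by rewrite /eta; field; lra.
have ce0 : 0 < c * eta by rewrite mulr_gt0.
(* 16 = 2 * 2 * 4: the step that uses this bounds ln L by 2 ln (4 K), which has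
   to stay within half of the gap c eta K. *)
have [T2 hT2] : exists T, forall x, T <= x -> ln x <= c * eta / 16 * x.
  by apply: ln_le_linear; rewrite divr_gt0.
exists (Num.max (expR Y) (Num.max T2 ((2 * c - ln c) * 2 / (c * eta)))).
move=> K P L; rewrite !ge_max => /and3P[KY KT2 Kc] KP hP hL LK.
have K0 : 0 < K by apply: lt_le_trans KY; apply: expR_gt0.
have P0 : 0 < P by apply: lt_le_trans KP.
have L0 : 0 < L by apply: lt_le_trans hL; rewrite mulr_gt0.
set y := ln P in hP LK *; set M := ln L.
have : Y <= y.
  rewrite /y -(expRK Y) ler_ln ?posrE ?expR_gt0 //; exact: le_trans KY KP.
rewrite !ge_max => /and3P[y1 yT1 yb].
have y0 : 0 < y by lra.
have yM : (1 - d) * y <= M.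
  have h1 : c ^+ 2 / 4 * P <= L * y.
    apply: (@le_trans _ _ (c * K * y)); last by rewrite ler_pM2r.
    have : c * (c * P / 4) <= c * (K * y) by rewrite ler_pM2l.
    lra.
  have c20 : 0 < c ^+ 2 / 4 by rewrite divr_gt0 ?exprn_gt0.
  have : ln (c ^+ 2 / 4 * P) <= ln (L * y) by rewrite ler_ln // posrE mulr_gt0.
  rewrite lnM ?posrE // [ln (L * y)]lnM ?posrE // -/b -/y -/M => h2.
  have h3 := hT1 _ yT1.
  move: yb; rewrite ler_pdivrMr // => h4; lra.
have y2M : y <= 2 * M by nra.
have M0 : 0 < M by lra.
have Lx : L / ((1 + eps) * M) <= K * (1 - eta).
  rewrite ler_pdivrMr ?mulr_gt0 ?addr_gt0 // etaE.
  apply: le_trans LK _; rewrite -mulrA ler_pM2l //.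
  rewrite mulrC ler_pdivlMr ?addr_gt0 ?divr_gt0 // -dE.
  by rewrite mulrC -mulrA ler_pM2l // addr_gt0.
have ML : M <= c * eta / 2 * K.
  (* L <= K y <= 2 K M <= 4 K sqrt L, so sqrt L <= 4 K. *)
  have s0 : 0 < Num.sqrt L by rewrite sqrtr_gt0.
  have Ms : M <= 2 * Num.sqrt L := ln_le_2sqrt L0.
  have s4K : Num.sqrt L <= 4 * K.
    rewrite -(ler_pM2r s0) -expr2 sqr_sqrtr ?(ltW L0) //.
    have : K * y <= K * (4 * Num.sqrt L) by rewrite ler_pM2l //; lra.
    lra.
  have -> : M = 2 * ln (Num.sqrt L).
    by rewrite /M -[in LHS](sqr_sqrtr (ltW L0)) lnXn // mulr_natl.
  have h1 : ln (Num.sqrt L) <= ln (4 * K) by rewrite ler_ln ?posrE ?mulr_gt0.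
  have h2 : ln (4 * K) <= c * eta / 16 * (4 * K) by apply: hT2; lra.
  lra.
move: Kc; rewrite ler_pdivrMr // => Kc.
have : L / ((1 + eps) * M) * c <= K * (1 - eta) * c by rewrite ler_pM2r.
lra.
Qed.

(** In use, [p] is the prime number k + 1 and [n] the product of the primes up to
[p].  Weakening the exponent 2^k - 1 to 2^(k - 1) costs only a constant in
[log_count_bound], where K = k + 1. *)
Lemma powR_powR_le_exp2 eps : 0 < eps -> exists K0 : nat, forall k p n : nat,
  (K0 <= k)%N -> (k < p)%N -> (2 ^ p./2 <= p ^ k.+1)%N ->
  (2 ^ k.+1 <= n)%N -> (n <= p ^ k.+1)%N ->
  n%:R `^ (2 `^ (ln n%:R / ((1 + eps) * ln (ln n%:R)))) <=
    (2 ^ (2 ^ k).-1)%:R :> R.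
Proof.
move=> e0; pose c : R := ln 2.
have c0 : 0 < c by rewrite ln_gt0 // ltr1n.
have [K0 hK0] := log_count_bound e0 c0.
exists (Num.truncn K0).+1 => k p n Kk kp h2p h2n hnp.
have p0 : (0 < p)%N by apply: leq_ltn_trans kp.
have n0 : (0 < n)%N by apply: leq_trans h2n; rewrite expn_gt0.
have lnX (a b : nat) : (0 < a)%N -> ln ((a ^ b)%:R) = b%:R * ln a%:R :> R.
  by move=> a0; rewrite natrX lnXn ?ltr0n // mulr_natl.
have lnle (a b : nat) : (0 < a)%N -> (a <= b)%N -> ln a%:R <= ln b%:R :> R.
  by move=> a0 ab; rewrite ler_ln ?posrE ?ltr0n ?ler_nat // (leq_trans a0).
have k0 : (0 < k)%N by apply: leq_trans Kk.
set L := ln n%:R; set x := L / _.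
have hL : c * k.+1%:R <= L by rewrite mulrC -lnX // lnle // expn_gt0.
have L0 : 0 < L by apply: lt_le_trans hL; rewrite mulr_gt0 ?ltr0n.
have main : ln L + x * c <= (k.+1%:R - 2) * c + ln c.
  apply: (hK0 _ p%:R) => //.
  - apply: ltW; apply: lt_le_trans (truncnS_gt K0) _.
    by rewrite ler_nat ltnW.
  - by rewrite ler_nat.
  - rewrite -lnX //; apply: le_trans (lnle _ _ _ h2p); last by rewrite expn_gt0.
    rewrite lnX // -/c -mulrA [leRHS]mulrC ler_pM2l //.
    rewrite ler_pdivrMr // -natrM ler_nat; lia.
  - by rewrite -lnX // lnle.
have x2 : 0 < 2 `^ x by rewrite powR_gt0.
rewrite -ler_ln ?posrE ?powR_gt0 ?ltr0n ?expn_gt0 //.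
rewrite ln_powR lnX // -/L -/c.
apply: (@le_trans _ _ ((2 ^ k.-1)%:R * c)); last first.
  rewrite ler_pM2r // ler_nat -[in leqRHS](prednK k0) expnS.
  by have := expn_gt0 2 k.-1; lia.
have k2 : 0 < (2 ^ k.-1)%:R :> R by rewrite ltr0n expn_gt0.
rewrite -ler_ln ?posrE ?mulr_gt0 // lnM ?posrE // [leRHS]lnM ?posrE //.
rewrite ln_powR lnX // -/c.
have -> : k.-1%:R = k.+1%:R - 2 :> R.
  by rewrite -[in RHS](prednK k0) -addn2 natrD addrK.
lra.
Qed.

End Asymptotics.

Theorem corollary1 (R : realType) (eps : R) (heps : 0 < eps) :
  exists N : nat, forall n : nat, (N <= n)%N -> primorial n ->
    n%:R `^ (2 `^ (ln n%:R / ((1 + eps) * ln (ln n%:R))))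
      <= (nb_irreducible_factorizations (cycles n n))%:R.
Proof.
have [K0 hK0] := powR_powR_le_exp2 heps.
(* Primorials increase, so a primorial above this one has a large index. *)
exists (kth_primorial K0.+1) => n Nn [[|k] [// _ nE]]; rewrite {}nE in Nn *.
have [s [us ss s1 sd sk]] := primorial_divisors k.
have Kk : (K0 <= k)%N.
  rewrite leqNgt; apply: contraTN Nn => kK; rewrite -ltnNge.
  apply: leq_ltn_trans (kth_primorial_le kK) _.
  rewrite kth_primorialS ltn_Pmulr ?kth_primorial_gt0 //.
  by rewrite prime_gt1 // prime_nth_prime.
apply: le_trans (hK0 _ _ _ Kk (nth_prime_gt k) (exp2_half_le k)
  (exp2_le_kth_primorial _) (kth_primorial_le_exp k)) _.
rewrite ler_nat -ss; apply: exp2_leq_nb_irreducible_factorizations => //.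
- by move=> d /sd dk; rewrite kth_primorialS dvdn_mulr.
- exact: ltnW.
- exact: kth_primorial_gt0.
Qed.
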